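(* Let $n>k\ge 0$ be integers such that $kn$ is even, and let $\mathbf{k^n}$ denote the degree sequence $(k,\dots,k)$ of length $n$. Then $\overline{\mu}(\mathbf{k^n})=k$, unless $k=2$ and $n$ is odd, or $k=4$ and $n\in\{5,7\}$; in these exceptional cases $\overline{\mu}(\mathbf{k^n})=k-1$.
   Context: All graphs are finite and simple. For a graph $G=(V,E)$ on $n$ vertices, a fractional vertex cover is a function $f:V\to[0,\infty)$ with $f(u)+f(v)\ge 1$ for every edge $uv\in E$; $\tau^*(G)$ denotes the minimum of $\sum_{v\in V}f(v)$ over all fractional vertex covers. For $E'\subseteq E$ let $G-E'=(V,E\setminus E')$. Define $\mu(G)=\min\{|E'| : E'\subseteq E,\ \tau^*(G-E')<n/2\}$ (equivalently, the minimum number of edges whose deletion leaves no perfect 2-matching, i.e. no spanning subgraph each of whose components is a $K_2$ or an odd cycle). For a graphical degree sequence $\mathbf d$, $\overline{\mu}(\mathbf d)$ is the maximum of $\mu(G)$ over all simple graphs $G$ realizing $\mathbf d$. *)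

(* Defs.v *)
From HB Require Import structures.
From mathcomp Require Import all_boot all_order all_algebra.
Set Implicit Arguments. Unset Strict Implicit. Unset Printing Implicit Defensive.
Import Order.TTheory GRing.Theory Num.Theory.

Definition is_graph (n : nat) (E : {set {set 'I_n}}) : Prop :=
  forall e, e \in E -> #|e| = 2.

Definition deg (n : nat) (E : {set {set 'I_n}}) (v : 'I_n) : nat :=
  #|[set e in E | v \in e]|.

Definition realizes_const (n k : nat) (E : {set {set 'I_n}}) : Prop :=
  is_graph E /\ forall v : 'I_n, deg E v = k.

Definition frac_vcover (R : realFieldType) (n : nat) (E : {set {set 'I_n}})
    (f : 'I_n -> R) : Prop :=
  (forall v, 0 <= f v)%R /\
  (forall u v : 'I_n, u != v -> [set u; v] \in E -> 1 <= f u + f v)%R.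

(* tau^*(G) < n/2, i.e. the minimum of sum f over fractional vertex covers
   is < n/2, i.e. some fractional vertex cover has total weight < n/2. *)
Definition tau_star_lt_half (R : realFieldType) (n : nat)
    (E : {set {set 'I_n}}) : Prop :=
  exists f : 'I_n -> R, frac_vcover E f /\
    (\sum_(v : 'I_n) f v < n%:R / 2)%R.

Definition is_mu (R : realFieldType) (n : nat) (E : {set {set 'I_n}})
    (m : nat) : Prop :=
  (exists E' : {set {set 'I_n}}, E' \subset E /\ #|E'| = m /\ tau_star_lt_half R (E :\: E')) /\
  (forall E' : {set {set 'I_n}}, E' \subset E -> tau_star_lt_half R (E :\: E') -> m <= #|E'|).

Definition is_mubar_const (R : realFieldType) (n k m : nat) : Prop :=
  (exists E : {set {set 'I_n}}, realizes_const k E /\ is_mu R E m) /\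
  (forall (E : {set {set 'I_n}}) (m' : nat),
      realizes_const k E -> is_mu R E m' -> m' <= m).

(* Main.v *)
(** The dual form of [tau* < n/2]: there are disjoint [S], [T] with [|T| < |S|]
    such that every edge leaving a vertex of [S] ends in [T].  Hence [mu] is the
    minimum, over such pairs, of the number of edges that meet [S] and avoid [T]
    ("stray" edges).  Isolating one vertex gives [mu <= k].

    For [k = 2d] the maximum is attained by the [d]-th power of the cycle [C_n].
    With [U] the complement of [S] and [T], counting degrees gives
    [2 * stray >= 2d (|S| - |T|) + cut U].  If [U] is nonempty, the [2d - 2] common
    neighbours of two consecutive vertices separated by [U], and the edge
    between them, give [cut U >= 2d - 1], so [stray >= 2d] by integrality.  If
    [U] is empty and [|S| = |T| + 1], then [n] is odd, [S] has more than half of the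
    vertices and meets each cycle of steps [j] in an edge, and the triangles
    [i, i+1, i+3] contribute [(n + 3)/2] edges inside [S] of step 1, 2 or 3; for
    [n = 2d + 1] all pairs in [S] are edges.
    For odd [k] add the perfect matching of antipodal vertices: it always
    contains one more stray edge.

    In the exceptional cases the better pair has [T] the complement of a set [S] with
    at most 3 edges ([k = 4]), or [S] and [T] alternate along an odd cycle ([k = 2]). *)
Require Import Defs.
From HB Require Import structures.
From mathcomp Require Import all_boot all_order all_algebra.
From mathcomp Require Import zify ring lra.
Set Implicit Arguments. Unset Strict Implicit. Unset Printing Implicit Defensive.
Import Order.TTheory GRing.Theory Num.Theory.

(** * Duality: fractional covers below half and deficient pairs *)

(* Induction on the support: unless [u = 0] works, shrinking all nonzero [|a v|] by
   their minimum does not decrease the sum. *)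
Lemma exists_threshold (R : realFieldType) (T : finType) (a : T -> R) :
  (0 < \sum_v a v)%R ->
  exists2 u : R, (0 <= u)%R & #|[set v | (a v < - u)%R]| < #|[set v | (u < a v)%R]|.
Proof.
have [m] := ubnP #|[set v | a v != 0%R]|.
elim: m a => // m IHm a; rewrite ltnS => le_supp_m sum_a_gt0.
have [lt_neg_pos|le_pos_neg] := ltnP #|[set v | (a v < 0)%R]| #|[set v | (0 < a v)%R]|.
  by exists 0%R; rewrite ?oppr0.
have /existsP[v0 v0P] : [exists v, a v != 0%R].
  apply: contraTT sum_a_gt0; rewrite negb_exists => /forallP a0.
  by rewrite big1 ?ltxx // => v _; apply/eqP; have := a0 v; rewrite negbK.
case: (@arg_minP _ _ _ v0 (fun v => a v != 0%R) (fun v => `|a v|%R) v0P) => v1 v1P v1min.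
set mu := `|a v1|%R in v1min.
have mu_gt0 : (0 < mu)%R by rewrite normr_gt0.
pose b v := (a v - mu * Num.sg (a v))%R.
have bE v : [\/ [/\ (a v = 0)%R & b v = 0%R], [/\ (mu <= a v)%R & (b v = a v - mu)%R]
            | [/\ (a v <= - mu)%R & (b v = a v + mu)%R]].
  rewrite /b; have := v1min v; have [av|av|->] := ltrgt0P (a v) => /= vmin.
  - by apply: Or32; rewrite gtr0_sg //; have := vmin isT; split; lra.
  - by apply: Or33; rewrite ltr0_sg //; have := vmin isT; split; lra.
  - by apply: Or31; rewrite sgr0 mulr0 subr0.
have supp_b : #|[set v | b v != 0%R]| < m.
  apply: leq_trans le_supp_m; apply: proper_card; apply/properP; split.
    apply/subsetP => v; rewrite !inE; apply: contra => /eqP av.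
    by rewrite /b av sgr0 mulr0 subr0.
  exists v1; rewrite inE // negbK /b -subr_eq0 subr0.
  by rewrite /mu mulrC -numEsg subrr.
have sum_b : (0 < \sum_v b v)%R.
  have -> : (\sum_v b v = \sum_v a v +
    mu * ((#|[set v | (a v < 0)%R]|)%:R - (#|[set v | (0 < a v)%R]|)%:R))%R.
    rewrite big_split /= -!sum1_card !natr_sum !(big_mkcond (fun v => v \in _)) -sumrB mulr_sumr.
    congr (_ + _)%R; apply: eq_bigr => v _; rewrite !inE.
    by have [av|av|av] := ltrgt0P (a v); rewrite ?(gtr0_sg av) ?(ltr0_sg av) ?av ?sgr0; ring.
  apply: (lt_le_trans sum_a_gt0); rewrite lerDl; apply: mulr_ge0; first exact: ltW.
  by rewrite subr_ge0 ler_nat.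
have [u u_ge0 lt_u] := IHm b supp_b sum_b.
exists (u + mu)%R; first lra.
have -> : [set v | (a v < - (u + mu))%R] = [set v | (b v < - u)%R].
  apply/setP => v; rewrite !inE; apply/idP/idP; case: (bE v) => -[? ?] ?; lra.
have -> // : [set v | (u + mu < a v)%R] = [set v | (u < b v)%R].
apply/setP => v; rewrite !inE; apply/idP/idP; case: (bE v) => -[? ?] ?; lra.
Qed.

(** Given a cover [f], apply the threshold [u] to [1/2 - f]: [S] is where [f < 1/2 - u] and [T]
    where [f > 1/2 + u], so an edge leaving [S] must end in [T]. Conversely the weights 0 on [S], 1
    on [T] and 1/2 elsewhere form a cover of total [n/2 - (|S| - |T|)/2]. *)
Lemma tau_star_lt_halfP (R : realFieldType) (n : nat) (E : {set {set 'I_n}}) :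
  tau_star_lt_half R E <->
  exists S T : {set 'I_n}, [/\ [disjoint S & T], #|T| < #|S| &
    forall u v, u != v -> [set u; v] \in E -> u \in S -> v \in T].
Proof.
split=> [[f [[_ f_cover] sum_f]]|[S [T [dST ltTS ST]]]].
  have [|u u_ge0 lt_u] := @exists_threshold R 'I_n (fun v => 1 / 2 - f v)%R.
    by rewrite sumrB sumr_const card_ord -mulr_natl; lra.
  exists [set v | (u < 1 / 2 - f v)%R], [set v | (1 / 2 - f v < - u)%R]; split=> //.
    rewrite -setI_eq0; apply/eqP/setP => v; rewrite !inE; apply/negbTE/negP => /andP[]; lra.
  by move=> v w vw vwE; rewrite !inE; have := f_cover v w vw vwE; lra.
pose f v : R := ((v \in T)%:R / 2 + 1 / 2 - (v \in S)%:R / 2)%R.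
exists f; split; first split.
- by move=> v; rewrite /f; case: (v \in T); case: (v \in S) => /=; lra.
- move=> u v uv uvE; rewrite /f.
  have uST := ST u v uv uvE; have vST := ST v u; rewrite eq_sym setUC in vST.
  have {vST}vST := vST uv uvE; have [uS|uS] := boolP (u \in S).
    rewrite (uST uS) (disjointFr dST uS); case: (boolP (v \in S)) => /= [|_]; last lra.
    by move=> vS; have := disjointFr dST vS; rewrite uST.
  have [/vST uT|_] := boolP (v \in S); rewrite ?uT /=.
    by case: (v \in T) => /=; lra.
  by case: (u \in T); case: (v \in T) => /=; lra.
rewrite /f sumrB big_split /= sumr_const card_ord -mulr_natl -!mulr_suml -!natr_sum.
rewrite -!big_mkcond !sum1_card.
have : (#|T|%:R < #|S|%:R :> R)%R by rewrite ltr_nat.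
lra.
Qed.

Definition deficient (n : nat) (S T : {set 'I_n}) : bool :=
  [disjoint S & T] && (#|T| < #|S|).

Definition stray (n : nat) (E : {set {set 'I_n}}) (S T : {set 'I_n}) :
    {set {set 'I_n}} :=
  [set e in E | ~~ [disjoint e & S] && [disjoint e & T]].

Lemma tau_star_lt_half_stray (R : realFieldType) (n : nat)
    (E : {set {set 'I_n}}) (S T : {set 'I_n}) :
  deficient S T -> tau_star_lt_half R (E :\: stray E S T).
Proof.
move=> /andP[dST ltTS]; apply/tau_star_lt_halfP; exists S, T; split=> // u v uv.
rewrite !inE => /andP[+ uvE] uS; rewrite uvE /= negb_and negbK; case/orP.
  by move/pred0P/(_ u); rewrite !inE eqxx uS.
case/pred0Pn => w; rewrite !inE => /andP[/orP[]/eqP -> //].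
by rewrite (disjointFr dST uS).
Qed.

Lemma stray_sub (R : realFieldType) (n : nat) (E E' : {set {set 'I_n}}) :
  is_graph E -> tau_star_lt_half R (E :\: E') ->
  exists S T : {set 'I_n}, deficient S T /\ stray E S T \subset E'.
Proof.
move=> gE /tau_star_lt_halfP[S [T [dST ltTS ST]]].
exists S, T; split; first exact/andP.
apply/subsetP => e; rewrite inE => /and3P[eE meetS disT].
apply: contraT => eNE'.
have /eqP/cards2P[x [y [xy exy]]] := gE e eE.
have eEE' : [set x; y] \in E :\: E' by rewrite -exy inE eNE'.
case/pred0Pn: meetS => w /=; rewrite exy !inE => /andP[/orP[]/eqP-> wS].
  have := disjointFr disT (x := y); rewrite exy !inE eqxx orbT => /(_ isT) <-.
  exact: ST xy eEE' wS.
have := disjointFr disT (x := x); rewrite exy !inE eqxx => /(_ isT) <-.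
by rewrite eq_sym in xy; apply: ST xy _ wS; rewrite setUC.
Qed.

(** Stray sets of deficient pairs are admissible deletions, and every admissible deletion contains
    one, so both bounds can be checked on deficient pairs alone. *)
Lemma is_mubar_const_stray (R : realFieldType) (n k m : nat) :
  (forall E : {set {set 'I_n}}, realizes_const k E ->
     exists S T : {set 'I_n}, deficient S T /\ #|stray E S T| <= m) ->
  (exists E : {set {set 'I_n}}, realizes_const k E /\
     forall S T : {set 'I_n}, deficient S T -> m <= #|stray E S T|) ->
  is_mubar_const R n k m.
Proof.
have stray_subE (E : {set {set 'I_n}}) S T : stray E S T \subset E.
  by apply/subsetP => e; rewrite inE => /andP[].
move=> upper [E [rE lower]]; split; last first.
  move=> F m' rF [_ minF]; have [S [T [dST]]] := upper F rF.
  exact/leq_trans/minF/tau_star_lt_half_stray.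
exists E; split=> //; split; last first.
  move=> E' _ /(stray_sub rE.1)[S [T [dST /subset_leq_card]]].
  exact/leq_trans/lower.
have [S [T [dST le_m]]] := upper E rE.
exists (stray E S T); split; first exact: stray_subE.
split; last exact: tau_star_lt_half_stray.
by apply/eqP; rewrite eqn_leq le_m lower.
Qed.

(** * Neighbourhoods in a graph *)

Definition nbr (n : nat) (E : {set {set 'I_n}}) (v : 'I_n) : {set 'I_n} :=
  [set u | [set v; u] \in E].

Lemma nbr_neq (n : nat) (E : {set {set 'I_n}}) (u v : 'I_n) :
  is_graph E -> u \in nbr E v -> u != v.
Proof.
by move=> gE; rewrite inE => /gE; rewrite cards2 eq_sym; case: (u == v).
Qed.

Lemma nbr_sym (n : nat) (E : {set {set 'I_n}}) (u v : 'I_n) :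
  (u \in nbr E v) = (v \in nbr E u).
Proof. by rewrite !inE setUC. Qed.

Lemma set2_inj (T : finType) (v u w : T) :
  u != v -> [set v; u] = [set v; w] -> u = w.
Proof.
move=> uv /setP/(_ u); rewrite !inE eqxx orbT (negPf uv) /=.
by move/esym/eqP.
Qed.

Lemma card_nbr (n : nat) (E : {set {set 'I_n}}) (v : 'I_n) :
  is_graph E -> #|nbr E v| = deg E v.
Proof.
move=> gE; rewrite -(card_in_imset (f := fun u => [set v; u])); last first.
  by move=> u w /(nbr_neq gE) uv _; apply: set2_inj.
rewrite /deg; congr #|pred_of_set _|; apply/setP => e; rewrite inE.
apply/imsetP/andP => [[u]|[eE ve]]; first by rewrite inE => uE ->; rewrite uE !inE eqxx.
have /eqP/cards2P[x [y [xy exy]]] := gE e eE.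
move: ve; rewrite exy !inE => /orP[]/eqP->; [exists y|exists x] => //.
- by rewrite inE -exy.
- by rewrite inE setUC -exy.
- by rewrite setUC.
Qed.

(** * Upper bounds: isolating a vertex, and the orders 5 and 7 *)

Lemma deficient_setC (n : nat) (S : {set 'I_n}) : n < #|S|.*2 -> deficient S (~: S).
Proof.
move=> lt_n; rewrite /deficient -setI_eq0 setICr eqxx [#|~: S|]cardsCs setCK card_ord /=.
by move: (#|S|) lt_n => s; lia.
Qed.

Lemma stray_setC (n : nat) (E : {set {set 'I_n}}) (S : {set 'I_n}) e :
  e \in stray E S (~: S) -> e \in E /\ e \subset S.
Proof.
by rewrite inE => /and3P[-> _]; rewrite -subsets_disjoint.
Qed.

Lemma upper_degree (n k : nat) (E : {set {set 'I_n}}) :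
  0 < n -> realizes_const k E ->
  exists S T : {set 'I_n}, deficient S T /\ #|stray E S T| <= k.
Proof.
case: n E => // n E _ [gE dE]; exists [set ord0], set0.
rewrite /deficient cards0 cards1 -setI_eq0 setI0 eqxx; split=> //.
rewrite -(dE ord0); apply: subset_leq_card; apply/subsetP => e.
rewrite !inE => /and3P[-> + _] /=; rewrite disjoint_sym disjoints1.
by rewrite negbK.
Qed.

(** Any three of the five vertices outnumber the other two and span at most three edges. *)
Lemma upper_order5 (E : {set {set 'I_5}}) :
  is_graph E -> exists S T : {set 'I_5}, deficient S T /\ #|stray E S T| <= 3.
Proof.
move=> gE; pose S : {set 'I_5} := [set i : 'I_5 | i < 3].
have cS : #|S| = 3.
  by rewrite -sum1_card big_mkcond !big_ord_recl big_ord0 !inE.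
exists S, (~: S); split; first by apply: deficient_setC; rewrite cS.
have c3 : 'C(#|S|, 2) = 3 by rewrite cS.
rewrite -[leqRHS]c3 -cards_draws; apply: subset_leq_card.
apply/subsetP => e eS; rewrite inE; have [eE ->] := stray_setC eS.
by rewrite gE.
Qed.

Lemma mem_pairs (T U : eqType) (f : T -> T -> U) (x y z t p q : T) :
  (forall i j, f i j = f j i) -> p != q ->
  p \in [:: x; y; z; t] -> q \in [:: x; y; z; t] ->
  f p q \in [:: f x y; f x z; f x t; f y z; f y t; f z t].
Proof.
move=> fC + pS qS; rewrite !inE in pS qS *.
by case/or4P: pS => /eqP ->; case/or4P: qS => /eqP ->; rewrite ?eqxx ?orbT // => _;
  rewrite fC eqxx ?orbT.
Qed.

(** Since [n < 8], four vertices outnumber the rest. The list [l] holds those of their six pairs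
    that may be edges, so [size l] bounds the edges they span. *)
Lemma upper_four_vertices (n : nat) (E : {set {set 'I_n}}) (x y z t : 'I_n)
    (l : seq {set 'I_n}) :
  n < 8 -> is_graph E -> uniq [:: x; y; z; t] ->
  {in [:: [set x; y]; [set x; z]; [set x; t]; [set y; z]; [set y; t]; [set z; t]],
     forall e, e \in E -> e \in l} ->
  exists S T : {set 'I_n}, deficient S T /\ #|stray E S T| <= size l.
Proof.
move=> n8 gE uS inl; pose S := [set i in [:: x; y; z; t]].
exists S, (~: S); split.
  by apply: deficient_setC; rewrite cardsE (card_uniqP uS).
apply: leq_trans (card_size l); apply: subset_leq_card.
apply/subsetP => e /stray_setC[eE eS]; apply: inl => //.
have /eqP/cards2P[p [q [pq epq]]] := gE e eE.
have := subsetP eS p; have := subsetP eS q;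
rewrite epq !in_set2 !eqxx orbT !(in_set (mem_seq [:: x; y; z; t])) /=.
move=> /(_ isT) qS /(_ isT) pS.
apply: (mem_pairs (f := fun i j => [set i; j])) => // i j; exact: setUC.
Qed.

(** The complement graph is 2-regular, and four vertices carrying at least three non-edges suffice.
    Let [a], [b] be the non-neighbours of [v]. If [a] and [b] are not adjacent, [v], [a], [b] are
    pairwise non-adjacent and any fourth vertex will do. Otherwise a second non-neighbour [c] of [a]
    gives the path [b], [v], [a], [c] of non-edges. *)
Lemma upper_order7 (n : nat) (E : {set {set 'I_n}}) :
  n = 7 -> realizes_const 4 E ->
  exists S T : {set 'I_n}, deficient S T /\ #|stray E S T| <= 3.
Proof.
move=> n7 [gE dE].
have nonnbr v : exists a b,
    [/\ uniq [:: v; a; b], [set v; a] \notin E & [set v; b] \notin E].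
  have vN : v \notin nbr E v by apply/negP => /(nbr_neq gE); rewrite eqxx.
  have /eqP/cards2P[a [b [ab Eab]]] : #|~: (v |: nbr E v)| = 2.
    by rewrite cardsCs setCK cardsU1 vN card_ord card_nbr // dE n7.
  exists a, b.
  have {}Eab x : (x \in ~: (v |: nbr E v)) = (x \in [set a; b]) by rewrite Eab.
  have := Eab a; have := Eab b; rewrite !inE !eqxx orbT /=.
  move=> /norP[bv bE] /norP[av aE]; split=> //=.
  by rewrite !inE negb_or ![v == _]eq_sym av bv ab.
have n_gt0 : 0 < n by rewrite n7.
have [a [b [uv va vb]]] := nonnbr (Ordinal n_gt0).
move: (Ordinal n_gt0) uv va vb => v uv va vb.
have [abE|abE] := boolP ([set a; b] \in E).
  have [c1 [c2 [uc ac1 ac2]]] := nonnbr a.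
  have [c [cv ca acE]] : exists c, [/\ c != v, c != a & [set a; c] \notin E].
    have [c1v|c1v] := eqVneq c1 v; [exists c2|exists c1]; split=> //;
      by move: uc; rewrite /= !inE negb_or -?c1v => /and3P[/andP[? ?] ? _]; rewrite // eq_sym.
  have cb : c != b by apply: contraNneq acE => ->.
  apply: (upper_four_vertices (l := [:: [set v; c]; [set a; b]; [set b; c]])
    (x := v) (y := a) (z := b) (t := c)) => //; first by rewrite n7.
    move: uv; rewrite /= !inE !negb_or => /and3P[/andP[-> ->] -> _].
    by rewrite ![_ == c]eq_sym cv ca cb.
  move=> e; rewrite !inE => /or4P[|||/or3P[]] /eqP->.
  - by rewrite (negPf va).
  - by rewrite (negPf vb).
  - by rewrite eqxx.
  - by rewrite eqxx orbT.
  - by rewrite (negPf acE).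
  - by rewrite eqxx !orbT.
have /existsP[c] : [exists c, c \notin [:: v; a; b]].
  rewrite -negb_forall; apply/negP => /forallP allS.
  have : #|'I_n| <= 3.
    by apply: leq_trans (card_size [:: v; a; b]); apply: subset_leq_card;
      apply/subsetP => x _; apply: allS.
  by rewrite card_ord n7.
rewrite !inE !negb_or => /and3P[cv ca cb].
apply: (upper_four_vertices (l := [:: [set v; c]; [set a; c]; [set b; c]])
    (x := v) (y := a) (z := b) (t := c)) => //; first by rewrite n7.
  move: uv; rewrite /= !inE !negb_or => /and3P[/andP[-> ->] -> _].
  by rewrite ![_ == c]eq_sym cv ca cb.
move=> e; rewrite !inE => /or4P[|||/or3P[]] /eqP->.
- by rewrite (negPf va).
- by rewrite (negPf vb).
- by rewrite eqxx.
- by rewrite (negPf abE).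
- by rewrite eqxx orbT.
- by rewrite eqxx !orbT.
Qed.

(** * Odd cycles in 2-regular graphs of odd order *)

Lemma card2_cases (T : finType) (A : {set T}) (a b c : T) :
  #|A| = 2 -> a \in A -> b \in A -> a != b -> c \in A -> c = a \/ c = b.
Proof.
move=> cA aA bA ab cA'.
have /eqP AE : [set a; b] == A by rewrite eqEcard cA cards2 ab andbT subUset !sub1set aA.
by move: cA'; rewrite -AE !inE => /orP[]/eqP; auto.
Qed.

(* The last disjunct of the conclusion allows only the closing edge, between
   positions [0] and [size p - 1], to join positions of equal parity. *)
Definition closed_cycle (n : nat) (E : {set {set 'I_n}}) (x : 'I_n) (p : seq 'I_n) :=
  uniq p /\ forall i u, i < size p -> u \in nbr E (nth x p i) ->
  exists j, [/\ j < size p, u = nth x p j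
    & (odd j != odd i) || (i == 0) && (j.+1 == size p) || (j == 0) && (i.+1 == size p)].

(** Extend the path at its head [y] until both neighbours of [y] lie on it. An inner vertex has only
    its predecessor and successor as neighbours, so those of [y] are at position 1 and at the last
    position: the path closes up. *)
Lemma path_closed_cycle (n : nat) (E : {set {set 'I_n}}) (W : {set 'I_n})
    (x y : 'I_n) (q : seq 'I_n) :
  realizes_const 2 E -> (forall u v, u \in W -> v \in nbr E u -> v \in W) ->
  uniq (y :: q) -> path (fun u v => v \in nbr E u) y q -> {subset y :: q <= W} ->
  exists p, [/\ closed_cycle E x p, 0 < size p & {subset p <= W}].
Proof.
move=> [gE dE] closedW; have nbr2 v : #|nbr E v| = 2 by rewrite card_nbr.
have [m] := ubnP (n - size q); elim: m y q => // m IHm y q lt_m uq pq qW.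
have size_q : size q < n.
  by have := max_card (mem (y :: q)); rewrite (card_uniqP uq) card_ord.
have [/existsP[z /andP[zy zq]]|] := boolP [exists z, (z \in nbr E y) && (z \notin y :: q)].
  apply: (IHm z (y :: q)) => //.
  - by rewrite /=; lia.
  - by rewrite cons_uniq zq.
  - by rewrite /= nbr_sym zy.
  - move=> u; rewrite inE => /predU1P[->|]; last exact: qW.
    by apply: closedW zy; apply: qW; rewrite mem_head.
rewrite negb_exists => /forallP noext.
have nbr_q z : z \in nbr E y -> z \in y :: q.
  by move=> zy; have := noext z; rewrite zy negbK.
exists (y :: q); split=> //; split=> //.
set p := y :: q in uq qW nbr_q *; have [N NE] : {N | N = size p} by exists (size p).
have nth_eq i j : i < N -> j < N -> (nth x p i == nth x p j) = (i == j).
  by rewrite NE => iN jN; rewrite nth_uniq.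
have succ i : i.+1 < N -> nth x p i.+1 \in nbr E (nth x p i).
  by move=> ltiN; have /(pathP x)/(_ i) := pq; apply; rewrite -ltnS -[X in _ < X]NE.
have pred i : 0 < i -> i < N -> nth x p i.-1 \in nbr E (nth x p i).
  by case: i => // i _ ltiN; rewrite nbr_sym succ.
have nth_neq i j : i < N -> j < N -> i != j -> nth x p i != nth x p j.
  by move=> iN jN; rewrite nth_eq.
have inner i u : 0 < i -> i.+1 < N -> u \in nbr E (nth x p i) ->
    u = nth x p i.-1 \/ u = nth x p i.+1.
  move=> i_gt0 iN; apply: card2_cases => //; first by apply: pred; lia.
    exact: succ.
  by apply: nth_neq; lia.
have ends z : z \in nbr E y -> exists i, [/\ 0 < i, i < N, z = nth x p i & i = 1 \/ i.+1 = N].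
  move=> zy; have zp := nbr_q z zy; exists (index z p).
  have zN : index z p < N by rewrite NE index_mem.
  have z_gt0 : 0 < index z p.
    by rewrite lt0n; apply: contraTneq zy => z0;
      rewrite -(nth_index x zp) z0; apply/negP => /(nbr_neq gE); rewrite eqxx.
  split; rewrite ?nth_index //.
  have [->|zN'] := eqVneq (index z p).+1 N; first by right.
  have lt_z : (index z p).+1 < N by rewrite ltn_neqAle zN' zN.
  have yz : nth x p 0 \in nbr E (nth x p (index z p)) by rewrite nth_index // nbr_sym.
  left; have [/eqP|/eqP] := inner _ _ z_gt0 lt_z yz; rewrite nth_eq //; lia.
have /eqP/cards2P[z1 [z2 [z12 Ez]]] := nbr2 y.
have [|i1 [i1_gt0 i1N z1E i1P]] := ends z1; first by rewrite Ez !inE eqxx.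
have [|i2 [i2_gt0 i2N z2E i2P]] := ends z2; first by rewrite Ez !inE eqxx orbT.
have i12 : i1 <> i2 by move=> i12; move: z12; rewrite z1E z2E i12 eqxx.
have N3 : 2 < N by lia.
have last_first : nth x p N.-1 \in nbr E y.
  case: (i1P) => [i1E|<-]; last by rewrite -z1E Ez !inE eqxx.
  case: (i2P) => [i2E|<-]; last by rewrite -z2E Ez !inE eqxx orbT.
  by lia.
move=> i u; rewrite -NE => iN ui.
have [i0|i0] := eqVneq i 0.
  rewrite i0 in ui *; have [j [j0 jN uE jP]] := ends u ui.
  by exists j; split=> //; case: jP => [->|<-] //; rewrite eqxx orbT.
have [iN1|iN1] := eqVneq i.+1 N.
  have prev_i : nth x p i.-1 \in nbr E (nth x p i) by apply: pred; lia.
  have first_i : nth x p 0 \in nbr E (nth x p i) by rewrite nbr_sym -[i]/(i.+1.-1) iN1.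
  have neq0 : nth x p i.-1 != nth x p 0 by apply: nth_neq; lia.
  have [uE|uE] := card2_cases (nbr2 _) prev_i first_i neq0 ui.
    by exists i.-1; split=> //; lia.
  by exists 0; split=> //; lia.
have [i_gt0 ltiN] : 0 < i /\ i.+1 < N by lia.
have [uE|uE] := inner i u i_gt0 ltiN ui.
- by exists i.-1; split=> //; lia.
- by exists i.+1; split=> //; lia.
Qed.

(** Removing an even cycle from [W] leaves a smaller set that is again closed under neighbours and
    of odd size, so an odd cycle is eventually found. *)
Lemma odd_closed_cycle (n : nat) (E : {set {set 'I_n}}) (x : 'I_n) (W : {set 'I_n}) :
  realizes_const 2 E -> (forall u v, u \in W -> v \in nbr E u -> v \in W) ->
  odd #|W| -> exists p, closed_cycle E x p /\ odd (size p).
Proof.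
move=> rE; have [m] := ubnP #|W|; elim: m W => // m IHm W lt_m closedW oddW.
have /card_gt0P[y yW] : 0 < #|W| by case: #|W| oddW.
have [|||p [cycp p_gt0 pW]] := @path_closed_cycle n E W x y [::] rE closedW => //.
  by move=> u; rewrite inE => /eqP->.
have [oddp|evenp] := boolP (odd (size p)); first by exists p.
have cardP : #|[set u in p]| = size p by rewrite cardsE (card_uniqP cycp.1).
have subP : [set u in p] \subset W by apply/subsetP => u; rewrite inE; apply: pW.
have cardD : #|W :\: [set u in p]| = #|W| - size p.
  by rewrite cardsD (setIidPr subP) cardP.
have leP : size p <= #|W| by rewrite -cardP subset_leq_card.
apply: (IHm (W :\: [set u in p])).
- rewrite cardD; lia.
- move=> u v; rewrite !inE => /andP[up uW] vu; rewrite (closedW u v) // ?andbT ?inE //.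
  apply: contra up => vp; have iN : index v p < size p by rewrite index_mem.
  have [|j [jN -> _]] := cycp.2 _ u iN; last exact: mem_nth.
  by rewrite nth_index // nbr_sym inE.
- by rewrite cardD oddB // oddW (negPf evenp).
Qed.

Lemma count_odd_iota (n : nat) : count odd (iota 0 n) = n./2.
Proof.
elim: n => // n IHn; rewrite -addn1 iotaD count_cat IHn /= addn0 addn1 /=.
by rewrite uphalf_half addnC.
Qed.

Lemma card_index (T : finType) (x : T) (p : seq T) (P : pred nat) : uniq p ->
  #|[set v in p | P (index v p)]| = count P (iota 0 (size p)).
Proof.
move=> up; rewrite cardsE.
have -> : #|[pred v in p | P (index v p)]| = size [seq v <- p | P (index v p)].
  rewrite -(card_uniqP _) ?filter_uniq //; apply: eq_card => v.
  by rewrite mem_filter !inE andbC.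
rewrite size_filter -[in LHS](mkseq_nth x p) /mkseq count_map.
apply: eq_in_count => i; rewrite mem_iota /= => iN.
by rewrite -/(mkseq (nth x p) (size p)) mkseq_nth index_uniq.
Qed.

(** On an odd cycle the even positions outnumber the odd ones by one, and the closing edge is the
    only edge from an even position that does not end at an odd one. *)
Lemma upper_odd_2regular (n : nat) (E : {set {set 'I_n}}) :
  odd n -> realizes_const 2 E ->
  exists S T : {set 'I_n}, deficient S T /\ #|stray E S T| <= 1.
Proof.
move=> oddn rE; have n_gt0 : 0 < n by case: n oddn {E rE}.
have [|p [[up cycp] oddp]] := @odd_closed_cycle n E (Ordinal n_gt0) setT rE
  (fun _ _ _ _ => in_setT _).
  by rewrite cardsT card_ord.
move: (Ordinal n_gt0) cycp => x cycp.
exists [set v in p | predC odd (index v p)], [set v in p | odd (index v p)]; split.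
  apply/andP; split.
    by rewrite -setI_eq0; apply/eqP/setP => v; rewrite !inE; case: odd; rewrite !andbF.
  rewrite (card_index x odd up) (card_index x (predC odd) up).
  have := count_predC odd (iota 0 (size p)).
  rewrite size_iota count_odd_iota; move: (count _ _) => c; lia.
rewrite -(cards1 [set nth x p 0; nth x p (size p).-1]); apply: subset_leq_card.
apply/subsetP => e; rewrite inE => /and3P[eE meetS disT].
have /eqP/cards2P[a [b [ab eab]]] := rE.1 e eE.
have {meetS} [v [w [eE' vp ev]]] : exists v w, [/\ e = [set v; w], v \in p & ~~ odd (index v p)].
  case/pred0Pn: meetS => v /= /andP[+]; rewrite eab !inE => /orP[]/eqP-> /andP[ap ea].
    by exists a, b.
  by exists b, a; rewrite setUC.
have [||j [jN wE]] := cycp (index v p) w; rewrite ?index_mem //.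
  by rewrite nth_index // inE -eE'.
have wp : w \in p by rewrite wE mem_nth.
have jE : index w p = j by rewrite wE index_uniq.
have := disjointFr disT (x := w); rewrite eE' !inE eqxx orbT wp jE /= => /(_ isT) ->.
rewrite (negPf ev) /= => /orP[]/andP[/eqP i0 /eqP iN].
  by rewrite -i0 -iN /= nth_index // wE.
by rewrite -iN -i0 /= nth_index // -wE setUC.
Qed.

(** * Counting edges by step in the cyclic group of order [p + 2] *)

Lemma leq_sum_uniq (T : finType) (F : T -> nat) (s : seq T) :
  uniq s -> \sum_(v <- s) F v <= \sum_v F v.
Proof.
by move=> us; rewrite big_uniq //= [leqRHS](bigID [in s]) /= leq_addr.
Qed.

Lemma natr_Zp_neq0 (p m : nat) : 0 < m -> m < p.+2 -> (m%:R != 0 :> 'I_p.+2)%R.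
Proof.
move=> m_gt0 mp; apply/eqP => /(congr1 val).
by rewrite /= (@val_Zp_nat p.+2) // modn_small // => m0; rewrite m0 in m_gt0.
Qed.

Lemma sum_shift (p : nat) (F : 'I_p.+2 -> nat) (a : 'I_p.+2) :
  \sum_v F (v + a)%R = \sum_v F v.
Proof. by rewrite [RHS](reindex_inj (addIr a)). Qed.

(** The order is written [p.+2] so that ['I_p.+2] is the ring of integers modulo [p + 2]. In this
    and the next two sums, [v] stands for the edge from [v] to [v + j]. *)
Definition cut_step (p : nat) (U : {set 'I_p.+2}) (j : nat) : nat :=
  \sum_v ((v \in U) != ((v + j%:R)%R \in U)).

Definition inner_step (p : nat) (S : {set 'I_p.+2}) (j : nat) : nat :=
  \sum_v ((v \in S) * ((v + j%:R)%R \in S)).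

Definition stray_step (p : nat) (S T : {set 'I_p.+2}) (j : nat) : nat :=
  \sum_v ((v \in S) && ((v + j%:R)%R \notin T) || ((v + j%:R)%R \in S) && (v \notin T)).

Lemma sum1_ord (n : nat) : \sum_(i < n) 1 = n.
Proof. by rewrite sum_nat_const card_ord muln1. Qed.

Lemma sum_mem (p : nat) (S : {set 'I_p.+2}) : \sum_v (v \in S : nat) = #|S|.
Proof. by rewrite -sum1_card -big_mkcond. Qed.

Lemma sum_mem_shift (p : nat) (S : {set 'I_p.+2}) a : \sum_v ((v + a)%R \in S : nat) = #|S|.
Proof. by rewrite (sum_shift (fun v => (v \in S : nat))) sum_mem. Qed.

(** Edge by edge: the ends in [S], plus one if the edge crosses the boundary of the remaining set,
    are at most the ends in [T], plus two if the edge is stray. Summing over one step counts every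
    vertex twice. *)
Lemma cut_le_stray (p : nat) (S T : {set 'I_p.+2}) (j : nat) : [disjoint S & T] ->
  #|S|.*2 + cut_step (~: (S :|: T)) j <= (stray_step S T j).*2 + #|T|.*2.
Proof.
move=> dST; rewrite -!addnn -{1}(sum_mem S) -(sum_mem_shift S j%:R%R).
rewrite -{1}(sum_mem T) -(sum_mem_shift T j%:R%R) -!big_split.
apply: leq_sum => v _; rewrite !inE.
have := disjointFr dST (x := v); have := disjointFr dST (x := (v + j%:R)%R).
case: (v \in S); case: (v \in T); case: ((v + j%:R)%R \in S); case: ((v + j%:R)%R \in T) => //=;
  by do ?[move=> /(_ isT)].
Qed.

Lemma inner_le_stray (p : nat) (S T : {set 'I_p.+2}) (j : nat) : [disjoint S & T] ->
  inner_step S j <= stray_step S T j.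
Proof.
move=> dST; apply: leq_sum => v _.
have := disjointFr dST (x := (v + j%:R)%R).
by case: (v \in S); case: ((v + j%:R)%R \in S) => //= ->.
Qed.

Lemma exists_exit (p : nat) (U : {set 'I_p.+2}) :
  U != set0 -> U != setT -> exists i, (i \in U) && ((i + 1)%R \notin U).
Proof.
case/set0Pn => x xU UT; apply/existsP; apply: contraR UT.
rewrite negb_exists => /forallP noexit.
have stepU i : i \in U -> (i + 1)%R \in U.
  by move=> iU; have := noexit i; rewrite iU negbK.
have walk m : (x + m%:R)%R \in U.
  by elim: m => [|m IHm]; rewrite ?addr0 // -natr1 addrA stepU.
apply/eqP/setP => y; rewrite inE.
by rewrite -(subrKC x y) -(natr_Zp (y - x)%R) walk.
Qed.

Lemma cut_bound (p d : nat) (U : {set 'I_p.+2}) :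
  U != set0 -> U != setT -> 0 < d -> d.*2 < p.+2 ->
  d.*2.-1 <= \sum_(j < d) cut_step U j.+1.
Proof.
move=> U0 UT d_gt0 lt_d; have [i /andP[iU i1U]] := exists_exit U0 UT.
pose c (v : 'I_p.+2) (j : nat) : nat := (v \in U) != ((v + j%:R)%R \in U).
(* The extra terms are the step-[d] edges at [i + 1 + d] and [i - d]; the other edges
   from these common neighbours to [i], [i + 1] have step [d + 1]. *)
suff: d.*2.-1 + c (i + 1)%R d + c (i - d%:R)%R d <= \sum_(j < d) cut_step U j.+1 by lia.
have neqD (x y : 'I_p.+2) m : (x + m%:R = y)%R -> 0 < m -> m < p.+2 -> (x != y)%R.
  move=> <- m0 mp; apply: contra (natr_Zp_neq0 m0 mp) => /eqP xE.
  by apply/eqP; apply: (addrI x); rewrite addr0.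
case: d d_gt0 lt_d => // d _; elim: d => [|d IHd] lt_d.
  rewrite big_ord1; apply: leq_trans (leq_sum_uniq (s := [:: i; i + 1; i - 1]%R) _ _).
    by rewrite !big_cons big_nil /c iU (negPf i1U) addn0 addnA.
  have n1 : (i - 1 != i)%R by apply: (@neqD _ _ 1); rewrite ?subrK.
  have n2 : (i - 1 != i + 1)%R by apply: (@neqD _ _ 2) => //; ring.
  have n3 : (i != i + 1)%R by apply: (@neqD _ _ 1).
  by rewrite !cons_uniq !in_cons !in_nil [(i == _ - _)%R]eq_sym [(_ + _ == _ - _)%R]eq_sym
    (negPf n1) (negPf n2) (negPf n3).
have lt_d1 : d.+1.*2 < p.+2 by lia.
have {}IHd := IHd lt_d1.
rewrite big_ord_recr /=.
have cutd : c (i + 1)%R d.+2 + c (i - d.+2%:R)%R d.+2 + c i d.+2 + c (i - d.+1%:R)%R d.+2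
    <= cut_step U d.+2.
  apply: leq_trans (leq_sum_uniq (s := [:: i + 1; i - d.+2%:R; i; i - d.+1%:R]%R) _ _).
    by rewrite !big_cons big_nil addn0 !addnA.
  have n1 : (i - d.+2%:R != i + 1)%R by apply: (@neqD _ _ d.+3); [ring|lia|lia].
  have n2 : (i != i + 1)%R by apply: (@neqD _ _ 1).
  have n3 : (i - d.+1%:R != i + 1)%R by apply: (@neqD _ _ d.+2); [ring|lia|lia].
  have n4 : (i - d.+2%:R != i)%R by apply: (@neqD _ _ d.+2); [ring|lia|lia].
  have n5 : (i - d.+2%:R != i - d.+1%:R)%R by apply: (@neqD _ _ 1); [ring|lia|lia].
  have n6 : (i - d.+1%:R != i)%R by apply: (@neqD _ _ d.+1); [ring|lia|lia].
  rewrite !cons_uniq !in_cons !in_nil [(i + 1 == _ - _)%R]eq_sym (negPf n1).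
  rewrite [(i + 1 == i)%R]eq_sym (negPf n2) [(i + 1 == _ - _)%R]eq_sym (negPf n3).
  by rewrite (negPf n4) (negPf n5) [(i == _)%R]eq_sym (negPf n6).
(* The vertex [i + d + 2] is reached from [i + 1] by step [d + 1] and from [i] by step [d + 2]. As
   [U] separates [i] from [i + 1], one of the two edges is cut. The next claim is the same for
   [i - (d + 1)]. Thus the old extra terms and the two middle terms of [cutd] together give the
   increase by 2. *)
have c1 : 1 <= c (i + 1)%R d.+1 + c i d.+2.
  rewrite /c iU (negPf i1U).
  have -> : (i + 1 + d.+1%:R = i + d.+2%:R)%R by ring.
  by case: (_ \in U).
have c2 : 1 <= c (i - d.+1%:R)%R d.+1 + c (i - d.+1%:R)%R d.+2.
  rewrite /c.
  have -> : (i - d.+1%:R + d.+1%:R = i)%R by ring.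
  have -> : (i - d.+1%:R + d.+2%:R = i + 1)%R by ring.
  by rewrite iU (negPf i1U); case: (_ \in U).
clearbody c; move: (\sum_(_ < _) _) IHd => s IHd;
lia.
Qed.

(** Inclusion-exclusion for [S] and its translate by [-j]. *)
Lemma inner_step_ge (p : nat) (S : {set 'I_p.+2}) (j : nat) :
  #|S|.*2 <= inner_step S j + p.+2.
Proof.
rewrite -addnn -{1}(sum_mem S) -(sum_mem_shift S j%:R%R) -[X in _ <= _ + X]sum1_ord /inner_step.
rewrite -!big_split; apply: leq_sum => v _.
by case: (v \in S); case: (_ \in S).
Qed.

(** In each triangle [v], [v + a], [v + a + b], the number of vertices in [S] exceeds the number of
    sides inside [S] by at most one. *)
Lemma inner_step_triangle (p : nat) (S : {set 'I_p.+2}) (a b : nat) :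
  3 * #|S| <= inner_step S a + inner_step S b + inner_step S (a + b) + p.+2.
Proof.
have -> : 3 * #|S| = #|S| + #|S| + #|S| by lia.
rewrite -{1}(sum_mem S) -{1}(sum_mem_shift S a%:R%R) -(sum_mem_shift S (a + b)%:R%R).
rewrite -[X in _ <= _ + X]sum1_ord /inner_step.
rewrite -[X in _ <= _ + X + _ + _](sum_shift _ a%:R%R).
rewrite -!big_split; apply: leq_sum => v _.
rewrite natrD addrA.
by case: (v \in S); case: (_ \in S); case: (_ \in S).
Qed.

Lemma inner_step_sym (p : nat) (S : {set 'I_p.+2}) (j : nat) :
  j <= p.+2 -> inner_step S (p.+2 - j) = inner_step S j.
Proof.
move=> jp; rewrite /inner_step -(sum_shift _ j%:R%R); apply: eq_bigr => v _.
by rewrite natrB // (@pchar_Zp p.+2) // sub0r addrK mulnC.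
Qed.

Lemma sum_palindrome (F : nat -> nat) (d : nat) :
  (forall j, j <= d -> F (d.*2.+1 - j) = F j) ->
  \sum_(j < d.*2.+1) F j = F 0 + (\sum_(j < d) F j.+1).*2.
Proof.
move=> symF; rewrite big_ord_recl -addnn big_split_ord /= -addnn; congr (_ + (_ + _)).
rewrite (reindex_inj rev_ord_inj); apply: eq_bigr => j _ /=.
by rewrite -(symF j.+1) //; congr F; rewrite /bump /=; have := ltn_ord j; lia.
Qed.

(** Sort the ordered pairs of [S] by their difference: difference 0 gives [|S|] pairs, and the
    differences [j] and [p + 2 - j] contribute equally. *)
Lemma inner_step_total (p d : nat) (S : {set 'I_p.+2}) : d.*2.+1 = p.+2 ->
  #|S| * #|S| = #|S| + (\sum_(j < d) inner_step S j.+1).*2.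
Proof.
move=> pd.
have inner0 : inner_step S 0 = #|S|.
  by rewrite -[RHS]sum_mem; apply: eq_bigr => v _; rewrite addr0; case: (v \in S).
have -> : #|S| * #|S| = \sum_(j < p.+2) inner_step S j.
  rewrite exchange_big /= -{1}sum_mem big_distrl /=; apply: eq_bigr => v _.
  rewrite -big_distrr /=; congr (_ * _).
  rewrite -[LHS](sum_mem_shift S v); apply: eq_bigr => j _.
  by rewrite natr_Zp addrC.
have -> : \sum_(j < p.+2) inner_step S j = \sum_(j < d.*2.+1) inner_step S j by rewrite pd.
rewrite sum_palindrome ?inner0 // => j jd; rewrite pd inner_step_sym //; lia.
Qed.

Lemma inner_half (p d : nat) (S : {set 'I_p.+2}) :
  0 < d -> d.*2 < p.+2 -> #|S|.*2 = p.+3 ->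
  (if (d == 1) || (d == 2) && ((p.+2 == 5) || (p.+2 == 7)) then d.*2.-1 else d.*2)
    <= \sum_(j < d) inner_step S j.+1.
Proof.
move=> d_gt0 lt_d cS.
have ge1 j : 1 <= inner_step S j by have := inner_step_ge S j; rewrite cS; lia.
have [c [cE cp]] : exists c, #|S| = c /\ c.*2 = p.+3 by exists #|S|.
have t11 := inner_step_triangle S 1 1; have t12 := inner_step_triangle S 1 2.
rewrite cE in t11 t12.
case: d d_gt0 lt_d => [|[|[|d]]] // _ lt_d.
- by rewrite big_ord1.
(* With [I1], [I2] the two counts and [n = p + 2], triangles of steps 1, 1, 2 give
   [2 I1 + I2 >= (n + 3)/2]. For [n >= 9] this is at least 6, which together with [I2 >= 1] forces
   [I1 + I2 >= 4]. *)
- have -> : \sum_(j < 2) inner_step S j.+1 = inner_step S 1 + inner_step S 2.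
    by rewrite !big_ord_recl big_ord0 addn0.
  rewrite /= in t11 *; have := ge1 1; have := ge1 2; rewrite -[1 + 1]/2 in t11.
  case: ifP; lia.
(* Here [d.+3] is the number of steps. If the order is [2 (d + 3) + 1], then [|S| = d + 4] and all
   [(d + 4)(d + 3)/2] pairs count. *)
have [tot|ntot] := eqVneq d.+3.*2.+1 p.+2.
  by have := inner_step_total S tot; rewrite cE /=; move: (\sum_(j < _) _) => s; nia.
(* Otherwise the odd order is at least [2 (d + 3) + 3]. Steps 1, 2, 3 then contribute at least
   [d + 6], and each of the other [d] steps at least 1. *)
have -> : \sum_(j < d.+3) inner_step S j.+1 =
    inner_step S 1 + (inner_step S 2 + (inner_step S 3 + \sum_(j < d) inner_step S j.+4)).
  by rewrite !big_ord_recl.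
have : \sum_(j < d) 1 <= \sum_(j < d) inner_step S j.+4 by apply: leq_sum.
rewrite sum1_ord /= -[1 + 2]/3 in t12 *; lia.
Qed.

Lemma stray_steps_ge (p d : nat) (S T : {set 'I_p.+2}) :
  d.*2 < p.+2 -> deficient S T ->
  (if (d == 1) && odd p || (d == 2) && ((p.+2 == 5) || (p.+2 == 7)) then d.*2.-1 else d.*2)
    <= \sum_(j < d) stray_step S T j.+1.
Proof.
move=> lt_d /andP[dST ltTS]; case: (posnP d) => [->//|d_gt0].
have sum_cut : d * #|S|.*2 + \sum_(j < d) cut_step (~: (S :|: T)) j.+1
   <= (\sum_(j < d) stray_step S T j.+1).*2 + d * #|T|.*2.
  have sum2 : \sum_(j < d) (stray_step S T j.+1).*2 = (\sum_(j < d) stray_step S T j.+1).*2.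
    by rewrite -[RHS]muln2 big_distrl; apply: eq_bigr => j _; rewrite /= muln2.
  have : \sum_(j < d) (#|S|.*2 + cut_step (~: (S :|: T)) j.+1)
      <= \sum_(j < d) ((stray_step S T j.+1).*2 + #|T|.*2).
    by apply: leq_sum => j _; apply: cut_le_stray.
  by rewrite !big_split /= !sum_nat_const card_ord sum2.
have cardST : #|S| + #|T| + #|~: (S :|: T)| = p.+2.
  by have := cardsC (S :|: T); rewrite cardsU (disjoint_setI0 dST) cards0 subn0 card_ord.
have [R0|R0] := eqVneq (~: (S :|: T)) set0.
  rewrite R0 cards0 addn0 in cardST.
  (* A surplus of two already gives [d (|S| - |T|) >= 2d] stray edges. With surplus one,
     [2 |S| = p + 3] and the order is odd. *)
  have [ST2|ST1] := leqP (#|T| + 2) #|S|; first by case: ifP => _; nia.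
  have := inner_half d_gt0 lt_d (S := S).
  have -> : #|S|.*2 = p.+3 by lia.
  have -> : odd p by lia.
  move=> /(_ erefl); rewrite andbT => /leq_trans; apply; apply: leq_sum => j _.
  exact: inner_le_stray.
have RT : ~: (S :|: T) != setT.
  by apply: contraTneq ltTS => RT; move: cardST; rewrite RT cardsT card_ord; lia.
have := cut_bound R0 RT d_gt0 lt_d; case: ifP => _; nia.
Qed.

(** * Powers of a cycle as circulant graphs *)

Definition step_edge (p d : nat) (q : 'I_p.+2 * 'I_d) : {set 'I_p.+2} :=
  [set q.1; (q.1 + q.2.+1%:R)%R].

Definition circulant (p d : nat) : {set {set 'I_p.+2}} :=
  [set step_edge q | q : 'I_p.+2 * 'I_d].

Lemma addr_neq (p m : nat) (v : 'I_p.+2) :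
  0 < m -> m < p.+2 -> (v != v + m%:R)%R.
Proof.
by move=> m0 mp; rewrite -subr_eq0 opprD addrA subrr sub0r oppr_eq0 natr_Zp_neq0.
Qed.

Lemma set2_eq (T : finType) (a b c e : T) :
  [set a; b] = [set c; e] -> (a = c /\ b = e) \/ (a = e /\ b = c).
Proof.
have [-> ebb|ab eab] := eqVneq a b.
  have [-> ->] : c = b /\ e = b; last by left.
  by split; apply/set1P; rewrite -[[set b]]setUid ebb !inE eqxx ?orbT.
have : a \in [set c; e] by rewrite -eab !inE eqxx.
rewrite !inE => /orP[]/eqP aE; [left|right]; split=> //; apply: (@set2_inj _ a).
- by rewrite eq_sym.
- by rewrite eab aE.
- by rewrite eq_sym.
- by rewrite eab aE setUC.
Qed.

Lemma natr_Zp_inj (p a b : nat) :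
  a < p.+2 -> b < p.+2 -> (a%:R = b%:R :> 'I_p.+2)%R -> a = b.
Proof.
by move=> ap bp /(congr1 val); rewrite /= !(@val_Zp_nat p.+2) // !modn_small.
Qed.

(** If two edges coincided with opposite directions, their steps would sum to 0 modulo [p + 2], but
    that sum lies between 2 and [2d]. *)
Lemma step_edge_inj (p d : nat) : d.*2 < p.+2 -> injective (@step_edge p d).
Proof.
move=> lt_d [u i] [v j] /set2_eq /= [[uv uivj]|[uE vE]].
  rewrite uv in uivj *; congr (_, _); apply: val_inj => /=.
  have := ltn_ord i; have := ltn_ord j => ? ?.
  by apply/succn_inj; apply: (@natr_Zp_inj p); [lia|lia|apply: (addrI v)].
have : ((j.+1 + i.+1)%:R == 0 :> 'I_p.+2)%R.
  apply/eqP; apply: (addrI v); rewrite addr0 natrD addrA -[X in (X + _)%R = _]uE.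
  exact: vE.
by have := ltn_ord i; have := ltn_ord j => ? ?; rewrite (negPf (natr_Zp_neq0 _ _)) //; lia.
Qed.

Lemma card_pairs (p d : nat) (P : 'I_p.+2 -> 'I_d -> bool) :
  #|[set q | P q.1 q.2]| = \sum_(j < d) \sum_v P v j.
Proof.
rewrite -sum1_card big_mkcond exchange_big pair_bigA /=.
by apply: eq_bigr => q _; rewrite inE; case: (P _ _).
Qed.

Lemma circulant_graph (p d : nat) : d.*2 < p.+2 -> is_graph (circulant p d).
Proof.
move=> lt_d e /imsetP[[v j] _ ->]; rewrite /step_edge cards2 addr_neq //=.
by have := ltn_ord j; lia.
Qed.

Lemma deg_circulant (p d : nat) (v : 'I_p.+2) :
  d.*2 < p.+2 -> deg (circulant p d) v = d.*2.
Proof.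
move=> lt_d; rewrite /deg.
have -> : [set e in circulant p d | v \in e] =
    [set step_edge q | q in [set q : 'I_p.+2 * 'I_d | v \in [set q.1; (q.1 + q.2.+1%:R)%R]]].
  apply/setP => e; rewrite inE; apply/andP/imsetP => [[/imsetP[q _ ->] vq]|[q + ->]].
    by exists q; rewrite ?inE //= -in_set2.
  by rewrite inE => vq; rewrite imset_f.
rewrite card_imset; last exact: step_edge_inj.
rewrite (card_pairs (fun u (j : 'I_d) => v \in [set u; (u + j.+1%:R)%R])).
rewrite -muln2 -[d in RHS]card_ord -sum_nat_const; apply: eq_bigr => j _.
have lt_j : j.+1 < p.+2 by have := ltn_ord j; lia.
(* Exactly two edges of step [j + 1] contain [v]: those starting at [v - (j + 1)] and at [v]. *)
have <- : #|[set (v - j.+1%:R)%R; v]| = 2.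
  by rewrite cards2 -[X in _ != X](subrK (j.+1%:R)%R) addr_neq.
rewrite -sum1_card [RHS]big_mkcond; apply: eq_bigr => u _; rewrite !inE orbC eq_sym.
by rewrite [v == u]eq_sym [(u == _ - _)%R]eq_sym subr_eq [(v == _ + _)%R]eq_sym; case: (_ || _).
Qed.

Lemma stray_circulant (p d : nat) (S T : {set 'I_p.+2}) :
  d.*2 < p.+2 -> [disjoint S & T] ->
  \sum_(j < d) stray_step S T j.+1 <= #|stray (circulant p d) S T|.
Proof.
move=> lt_d dST; rewrite /stray_step -card_pairs -(card_imset _ (step_edge_inj lt_d)).
apply: subset_leq_card; apply/subsetP => e /imsetP[[v j] + ->].
rewrite !inE /= => bad; rewrite imset_f //=.
set w := (v + _)%R in bad *; rewrite /step_edge /= -/w.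
have strayE (a b : 'I_p.+2) : a \in S -> b \notin T ->
    ~~ [disjoint [set a; b] & S] && [disjoint [set a; b] & T].
  move=> aS bT; apply/andP; split.
    by apply/pred0Pn; exists a; rewrite /= !inE eqxx.
  apply/pred0P => x /=; rewrite !inE; apply/negbTE/negP => /andP[/orP[]/eqP-> xT].
    by rewrite (disjointFr dST aS) in xT.
  by rewrite xT in bT.
by case/orP: bad => /andP[]; [|rewrite setUC]; apply: strayE.
Qed.

(** * The antipodal matching for odd degree *)

Definition antipodal (p : nat) : {set {set 'I_p.+2}} :=
  [set [set v; (v + (p.+2)./2%:R)%R] | v : 'I_p.+2].

Lemma mem_antipodal (p : nat) (v : 'I_p.+2) :
  [set v; (v + (p.+2)./2%:R)%R] \in antipodal p.
Proof. by apply/imsetP; exists v. Qed.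

Lemma add_half_twice (p : nat) (v : 'I_p.+2) :
  ~~ odd p -> (v + (p.+2)./2%:R + (p.+2)./2%:R = v)%R.
Proof.
move=> even_p; rewrite -addrA -natrD.
have -> : (p.+2)./2 + (p.+2)./2 = p.+2 by lia.
by rewrite (@pchar_Zp p.+2) // addr0.
Qed.

Lemma neq_add_half (p : nat) (v : 'I_p.+2) : (v != v + (p.+2)./2%:R)%R.
Proof. by apply: addr_neq; lia. Qed.

Lemma antipodal_graph (p : nat) : is_graph (antipodal p).
Proof. by move=> e /imsetP[v _ ->]; rewrite cards2 neq_add_half. Qed.

(** For even order a vertex and its antipode generate the same pair, so the pairs form a perfect
    matching. *)
Lemma deg_antipodal (p : nat) (v : 'I_p.+2) : ~~ odd p -> deg (antipodal p) v = 1.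
Proof.
move=> even_p; rewrite /deg -(cards1 [set v; (v + (p.+2)./2%:R)%R]);
congr #|pred_of_set _|; apply/setP => e.
rewrite !inE; apply/andP/eqP => [[/imsetP[u _ ->]]|->].
  by rewrite !inE => /orP[]/eqP -> //; rewrite add_half_twice // setUC.
by rewrite mem_antipodal !inE eqxx.
Qed.

(** With no stray edge, translation by half the order would inject [S] into [T]. *)
Lemma stray_antipodal (p : nat) (S T : {set 'I_p.+2}) :
  deficient S T -> 0 < #|stray (antipodal p) S T|.
Proof.
move=> /andP[dST ltTS]; rewrite card_gt0; apply: contraL ltTS => /eqP no_stray.
rewrite -leqNgt -(card_imset S (addIr (p.+2)./2%:R%R)); apply: subset_leq_card.
apply/subsetP => w /imsetP[v vS ->].
have : [set v; (v + (p.+2)./2%:R)%R] \notin stray (antipodal p) S T by rewrite no_stray inE.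
rewrite inE mem_antipodal /= negb_and negbK => /orP[/pred0P/(_ v)|/pred0Pn[x /andP[]]] /=.
  by rewrite !inE eqxx vS.
by rewrite !inE => /orP[]/eqP->; rewrite ?(disjointFr dST vS).
Qed.

Lemma circulant_antipodal (p d : nat) :
  ~~ odd p -> d.*2.+1 < p.+2 -> [disjoint circulant p d & antipodal p].
Proof.
move=> even_p lt_d; rewrite -setI_eq0; apply/eqP/setP => e; rewrite !inE.
apply/negbTE/negP => /andP[/imsetP[[v j] _ ->] /imsetP[u _]].
set h := (p.+2)./2; have lt_hp : h < p.+2 by rewrite /h; lia.
have lt_jh : j.+1 < h by have := ltn_ord j; rewrite /h; lia.
(* Since [j + 1 <= d < h < p + 2], the steps [j + 1] and [h] differ modulo [p + 2]. Reversing an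
   antipodal edge keeps its step [h], so both orientations lead to the same equation. *)
suff vh : [set v; (v + j.+1%:R)%R] = [set u; (u + h%:R)%R] -> (v + j.+1%:R = v + h%:R)%R.
  move=> /vh/addrI/natr_Zp_inj jh.
  by have := jh (ltn_trans lt_jh lt_hp) lt_hp; lia.
case/set2_eq => -[vE ->]; rewrite vE //.
by rewrite add_half_twice.
Qed.

Lemma stray_setU (n : nat) (E F : {set {set 'I_n}}) (S T : {set 'I_n}) :
  [disjoint E & F] -> #|stray (E :|: F) S T| = #|stray E S T| + #|stray F S T|.
Proof.
move=> dEF; have -> : stray (E :|: F) S T = stray E S T :|: stray F S T.
  by apply/setP => e; rewrite !inE andb_orl.
rewrite cardsU (_ : _ :&: _ = set0) ?cards0 ?subn0 //.
apply/setP => e; rewrite !inE; apply/negbTE/negP => /andP[/andP[eE _] /andP[eF _]].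
by rewrite (disjointFr dEF eE) in eF.
Qed.

Lemma deg_setU (n : nat) (E F : {set {set 'I_n}}) (v : 'I_n) :
  [disjoint E & F] -> deg (E :|: F) v = deg E v + deg F v.
Proof.
move=> dEF; rewrite /deg.
have -> : [set e in E :|: F | v \in e] = [set e in E | v \in e] :|: [set e in F | v \in e].
  by apply/setP => e; rewrite !inE andb_orl.
rewrite cardsU (_ : _ :&: _ = set0) ?cards0 ?subn0 //.
apply/setP => e; rewrite !inE; apply/negbTE/negP => /andP[/andP[eE _] /andP[eF _]].
by rewrite (disjointFr dEF eE) in eF.
Qed.

(** * Assembling the two bounds *)

Definition mubar_value (n k : nat) : nat :=
  if ((k == 2) && odd n) || ((k == 4) && ((n == 5) || (n == 7))) then k.-1 else k.

Lemma upper_bound (n k : nat) (E : {set {set 'I_n}}) : 0 < n -> realizes_const k E ->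
  exists S T : {set 'I_n}, deficient S T /\ #|stray E S T| <= mubar_value n k.
Proof.
move=> n_gt0 rE; rewrite /mubar_value.
case: ifP => [/orP[/andP[/eqP k2 oddn]|/andP[/eqP k4 /orP[]/eqP n57]]|_]; last exact: upper_degree.
- by rewrite k2 in rE *; apply: upper_odd_2regular.
- by rewrite k4; subst n; apply: upper_order5 rE.1.
- by rewrite k4 in rE *; apply: upper_order7.
Qed.

Lemma lower_bound (n k : nat) : k < n -> ~~ odd (k * n) ->
  exists E : {set {set 'I_n}}, realizes_const k E /\
    forall S T : {set 'I_n}, deficient S T -> mubar_value n k <= #|stray E S T|.
Proof.
(* Order 1 is treated apart, as the ring structure needs order at least 2; there [k = 0]. *)
case: n => [//|[|p]] lt_k even_kn.
  have -> : k = 0 by lia.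
  exists set0; split=> //; split=> [e|v]; first by rewrite inE.
  by apply/eqP; rewrite cards_eq0; apply/eqP/setP => e; rewrite !inE.
have kE := odd_double_half k; set d := k./2 in kE.
have lt_d : d.*2 < p.+2 by lia.
have circ S T : deficient S T -> mubar_value p.+2 d.*2 <= #|stray (circulant p d) S T|.
  move=> dST; apply: leq_trans (stray_circulant lt_d (andP dST).1).
  have := stray_steps_ge lt_d dST; rewrite /mubar_value.
  have -> : (d.*2 == 2) = (d == 1) by lia.
  have -> : (d.*2 == 4) = (d == 2) by lia.
  by rewrite /= negbK.
case oddk: (odd k) kE => kE; last first.
  exists (circulant p d); rewrite -kE; split=> //.
  by split=> [|v]; [apply: circulant_graph|apply: deg_circulant].
have even_p : ~~ odd p by move: even_kn; rewrite oddM oddk /= negbK.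
have dis : [disjoint circulant p d & antipodal p] by apply: circulant_antipodal => //; lia.
exists (circulant p d :|: antipodal p); rewrite -kE; split.
  split=> [e|v]; last by rewrite deg_setU // deg_circulant // deg_antipodal // addnC.
  by rewrite inE => /orP[]; [apply: circulant_graph|apply: antipodal_graph].
move=> S T dST; rewrite stray_setU //.
apply: leq_trans (leq_add (circ S T dST) (stray_antipodal dST)).
(* The order is even because [k] is odd, so neither [k] nor [2d] is exceptional and the bounds add
   up to [2d + 1 = k]. *)
rewrite /mubar_value; do 2![case: ifP]; lia.
Qed.

Theorem theorem34 (R : realFieldType) (n k : nat) :
  k < n -> ~~ odd (k * n) ->
  is_mubar_const R n k
    (if ((k == 2) && odd n) || ((k == 4) && ((n == 5) || (n == 7)))
     then k.-1 else k).
Proof.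
move=> lt_k even_kn; apply: is_mubar_const_stray; last exact: lower_bound.
by move=> E; apply: upper_bound; apply: leq_ltn_trans lt_k.
Qed.
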